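(* Let $X$ be a set, let $m,n\ge 2$ be integers, and let $f\in\Omega_m(X)$. Then \[I(\Omega_n(X),\odot_f)=\{g\in\Omega_n(X)\colon \mathrm{Img}(g)\subseteq I(X,f)\}.\] In particular, the following two statements hold. (1) If $I(X,f)=\{e\}$ for some $e\in X$, then $I(\Omega_n(X),\odot_f)=\{\gamma_e\}$. (2) If $I(\Omega_n(X),\odot_f)=\{g\}$ for some $g\in\Omega_n(X)$, then $g=\gamma_e$ for some $e\in X$. Moreover, $I(X,f)=\{e\}$.
   Context: For a set $Y$, $\Omega_m(Y)$ is the set of all $m$-ary operations $Y^m\to Y$. For $f\in\Omega_m(X)$, the $m$-ary operation $\odot_f$ on the set $\Omega_n(X)$ is defined by $\odot_f(g_1,\ldots,g_m)(\overline a):=f(g_1(\overline a),\ldots,g_m(\overline a))$ for all $g_1,\ldots,g_m\in\Omega_n(X)$ and $\overline a\in X^n$. For $F\in\Omega_m(Y)$ and an integer $0\le i<m$, $I_i(Y,F)$ is the set of all $e\in Y$ such that $F(\underbrace{e,\ldots,e}_{i},a,\underbrace{e,\ldots,e}_{m-i-1})=a$ for all $a\in Y$, and $I(Y,F):=\bigcap_{i=0}^{m-1}I_i(Y,F)$ is the set of identity elements of $(Y,F)$. For $g\in\Omega_n(X)$, $\mathrm{Img}(g):=\{g(\overline a)\colon\overline a\in X^n\}$. For $c\in X$, $\gamma_c\in\Omega_n(X)$ is the constant map $\gamma_c(\overline a):=c$ for all $\overline a\in X^n$.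
   Formalization: In part (2) the set X is assumed nonempty, since for empty X the only operation g is the unique identity element of Ω_n(X) but no e in X exists; the main equality and part (1) are for every set X. *)

(* Defs.v *)
From mathcomp Require Import all_boot.
From mathcomp Require Import boolp classical_sets.

Set Implicit Arguments.
Unset Strict Implicit.
Unset Printing Implicit Defensive.

Local Open Scope classical_set_scope.

Definition Omega (m : nat) (Y : Type) : Type := m.-tuple Y -> Y.

Definition odot (X : Type) (m n : nat) (f : Omega m X) : Omega m (Omega n X) :=
  fun g a => f [tuple tnth g i a | i < m].
Arguments odot {X m} n f.

(* (e, ..., e, a, e, ..., e) with i copies of e before a; positions are
   numbered from 0, as in tuples. *)
Definition with_entry (Y : Type) (m : nat) (i : 'I_m) (a e : Y) : m.-tuple Y :=
  [tuple if j == i then a else e | j < m].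

Definition identities_at (Y : Type) (m : nat) (F : Omega m Y) (i : 'I_m) :
    set Y :=
  [set e | forall a : Y, F (with_entry i a e) = a].

Definition identities (Y : Type) (m : nat) (F : Omega m Y) : set Y :=
  \bigcap_(i : 'I_m) identities_at F i.

Definition const_op (X : Type) (n : nat) (c : X) : Omega n X := fun _ => c.
Arguments const_op {X} n c.

(* Main.v *)
Require Import Defs.
From mathcomp Require Import all_boot.
From mathcomp Require Import boolp classical_sets.

Local Open Scope classical_set_scope.

(** The operation [odot n f] is [f] applied pointwise ([odot_with_entry]), so [g] satisfies its
    identity law as soon as each value [g a] satisfies that of [f]; constant operations give the
    converse, since they take every value of [X]. For (2), each identity of [f] yields a constant
    identity of [odot n f], which uniqueness forces to be [g]. *)

Lemma odot_with_entry (X : Type) (m n : nat) (f : Omega m X) (i : 'I_m)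
    (h g : Omega n X) (a : n.-tuple X) :
  odot n f (with_entry i h g) a = f (with_entry i (h a) (g a)).
Proof.
rewrite /odot; congr f; apply: eq_from_tnth => j.
by rewrite !tnth_mktuple; case: ifP.
Qed.

Lemma identities_odot (X : Type) (m n : nat) (f : Omega m X) :
  identities (odot n f) = [set g : Omega n X | range g `<=` identities f].
Proof.
apply/seteqP; split=> g /= Ig.
  move=> _ [a _ <-] i _ b.
  (* Test [g] against the constant operation with value [b], evaluated at [a]. *)
  by rewrite -[RHS]/(const_op n b a) -[in RHS](Ig i I (const_op n b))
    odot_with_entry.
move=> i _ h; apply/funext => a.
by rewrite odot_with_entry; apply: (Ig (g a)) => //; exists a.
Qed.

Theorem proposition3p5 (X : Type) (m n : nat) (f : Omega m X)
    (hm : (2 <= m)%N) (hn : (2 <= n)%N) :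
  [/\ identities (odot n f) =
        [set g : Omega n X | range g `<=` identities f],
      forall e : X, identities f = [set e] ->
        identities (odot n f) = [set const_op n e]
    & inhabited X -> forall g : Omega n X, identities (odot n f) = [set g] ->
        exists e : X, g = const_op n e /\ identities f = [set e]].
Proof.
split; first exact: identities_odot.
  move=> e Ife; rewrite identities_odot Ife; apply/seteqP; split=> g /=.
    by move=> ge; apply/funext => a; apply: ge; exists a.
  by move=> -> _ [a _ <-].
move=> [x0] g; rewrite identities_odot => Ig.
(* A point at which to evaluate [g]; over an empty [X], the empty operation is the only identity,
   yet no [e] exists. *)
pose a0 : n.-tuple X := [tuple x0 | _ < n].
have constE e : identities f e -> const_op n e = g.
  move=> Ie; suff : [set g] (const_op n e) by [].
  by rewrite -Ig => _ [a _ <-].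
have Iga0 : identities f (g a0).
  have : [set g] g by [].
  by rewrite -{1}Ig; apply; exists a0.
exists (g a0); split; first by rewrite constE.
apply/seteqP; split=> [e Ie|_ ->] //=.
(* As [g] is constantly [e], its value at [a0] is [e]. *)
by rewrite -(constE e Ie).
Qed.
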